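(* There exists a positive real number $\alpha$ that does not have a 1-free energy limit: there is no real number $\beta_c$ such that the limit $\lim_{N\to\infty}\frac{\log Z_N(\alpha;\beta)}{N}$ exists (as a real number) for all $\beta>\beta_c$.
   Context: Let $A_0=\begin{pmatrix}1&0\\1&1\end{pmatrix}$ and $A_1=\begin{pmatrix}1&1\\0&1\end{pmatrix}$. For a real number $\alpha$, a real number $\beta$ and a positive integer $N$, the Diophantine partition function is $$Z_N(\alpha;\beta)=\sum_{(i_1,\ldots,i_N)\in\{0,1\}^N}\frac{1}{|\alpha q-p|^{\beta}},$$ where $\binom{p}{q}$ denotes the right (second) column of the product $A_{i_1}A_{i_2}\cdots A_{i_N}$. A real $\alpha$ has a 1-free energy limit if there is $\beta_c$ such that $\lim_{N\to\infty}\log(Z_N(\alpha;\beta))/N$ exists for all $\beta>\beta_c$. *)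

(* Defs.v *)
From HB Require Import structures.
From mathcomp Require Export all_boot all_order all_algebra.
From mathcomp Require Export all_classical all_reals all_analysis.

Set Implicit Arguments.
Unset Strict Implicit.
Unset Printing Implicit Defensive.

Export Order.TTheory GRing.Theory Num.Theory.
Export numFieldNormedType.Exports.

Local Open Scope ring_scope.
Local Open Scope classical_set_scope.

Definition mx22 (a b c d : int) : 'M[int]_2 :=
  \matrix_(i < 2, j < 2) nth 0 (nth [::] [:: [:: a; b]; [:: c; d]] i) j.

(* The binary digit [i] is encoded as a boolean, with 0 = false, 1 = true. *)
Definition farey_mx (i : bool) : 'M[int]_2 :=
  if i then mx22 1 1
                 0 1
       else mx22 1 0
                 1 1.

Definition word_mx (N : nat) (w : N.-tuple bool) : 'M[int]_2 :=
  \prod_(j < N) farey_mx (tnth w j).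

Definition word_p (N : nat) (w : N.-tuple bool) : int :=
  word_mx w (inord 0) (inord 1).
Definition word_q (N : nat) (w : N.-tuple bool) : int :=
  word_mx w (inord 1) (inord 1).

Definition linear_form (R : realType) (alpha : R) (N : nat)
    (w : N.-tuple bool) : R :=
  alpha * (word_q w)%:~R - (word_p w)%:~R.

Definition partition_function (R : realType) (alpha beta : R) (N : nat) : R :=
  \sum_(w : N.-tuple bool) 1 / (`|linear_form alpha w| `^ beta).

(* No denominator |alpha q - p|^beta vanishes. Where this fails, 1 / 0 is a
   junk value and [partition_function] is not the intended sum. *)
Definition partition_function_defined (R : realType) (alpha : R) : Prop :=
  forall (N : nat) (w : N.-tuple bool), (0 < N)%N -> linear_form alpha w != 0.

Definition has_1_free_energy_limit (R : realType) (alpha : R) : Prop :=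
  exists beta_c : R, forall beta : R, beta_c < beta ->
    exists l : R,
      (fun N : nat => ln (partition_function alpha beta N) / N%:R) @ \oo --> l.

(* Main.v *)
(** Appending [m] copies of [A_0] to a word leaves the right column [(b, d)]
    unchanged and pushes the left column to [(a + m b, c + m d)]. Every real in
    the Farey interval of the longer word thus satisfies
    [|alpha d - b| <= 1 / (c + m d) <= 1 / m]. Iterating with [m = 2 ^ (N ^ 2)],
    where [N] is the current length, and separating the blocks by single letters
    [A_1] (so that the left endpoints strictly increase), yields an irrational
    [alpha] with [log Z_N >= beta N^2 log 2] for infinitely many [N], so that
    [log Z_N / N] is unbounded for every [beta > 0]. *)
Require Import Defs.
From mathcomp Require Import zify ring lra.

Local Open Scope ring_scope.

(* [(a, b, c, d)] encodes the matrix with rows [(a, b)] and [(c, d)]. *)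
Definition farey_step (v : nat * nat * nat * nat) (x : bool) :=
  let: (a, b, c, d) := v in
  if x then (a, a + b, c, c + d)%N else (a + b, b, c + d, d)%N.

Definition farey_quad (s : seq bool) := foldl farey_step (1, 0, 0, 1)%N s.

Definition quad_mx (v : nat * nat * nat * nat) : 'M[int]_2 :=
  let: (a, b, c, d) := v in mx22 a%:Z b%:Z c%:Z d%:Z.

Lemma quad_mx_step v x : quad_mx (farey_step v x) = quad_mx v * farey_mx x.
Proof.
move: v => [[[a b] c] d]; apply/matrixP => i j.
rewrite !mxE big_ord_recl big_ord1 /=.
case: x; rewrite /= !mxE; case: i => [[|[|//]] ?]; case: j => [[|[|//]] ?] /=; lia.
Qed.

Lemma quad_mxE s : \prod_(x <- s) farey_mx x = quad_mx (farey_quad s).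
Proof.
elim/last_ind: s => [|s x IH].
  rewrite big_nil; apply/matrixP => i j; rewrite !mxE.
  by case: i => [[|[|//]] ?]; case: j => [[|[|//]] ?].
by rewrite -cats1 big_cat big_seq1 /= IH cats1 /farey_quad foldl_rcons quad_mx_step.
Qed.

Definition left_p s := (farey_quad s).1.1.1.
Definition right_p s := (farey_quad s).1.1.2.
Definition left_q s := (farey_quad s).1.2.
Definition right_q s := (farey_quad s).2.

Lemma word_mxE N (w : N.-tuple bool) : word_mx w = quad_mx (farey_quad w).
Proof. by rewrite -quad_mxE big_tuple. Qed.

Lemma word_pE N (w : N.-tuple bool) : word_p w = (right_p w)%:Z.
Proof.
rewrite /word_p word_mxE /right_p; case: (farey_quad w) => [[[a b] c] d].
by rewrite mxE !inordK.
Qed.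

Lemma word_qE N (w : N.-tuple bool) : word_q w = (right_q w)%:Z.
Proof.
rewrite /word_q word_mxE /right_q; case: (farey_quad w) => [[[a b] c] d].
by rewrite mxE !inordK.
Qed.

(** Both letters have determinant 1. The relation is written additively because subtraction on [nat]
    truncates. *)
Lemma farey_det s : (left_p s * right_q s = right_p s * left_q s + 1)%N.
Proof.
rewrite /left_p /left_q /right_p /right_q.
elim/last_ind: s => [|s x]; first by [].
rewrite /farey_quad foldl_rcons -/(farey_quad s).
by case: (farey_quad s) => [[[a b] c] d] /= IH; case: x => /=; nia.
Qed.

Lemma right_q_gt0 s : (0 < right_q s)%N.
Proof. by have := farey_det s; case: (right_q s) => //; lia. Qed.

Lemma farey_quad_block s m :
  farey_quad (s ++ nseq m false ++ [:: true]) =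
  (left_p s + m * right_p s, left_p s + m.+1 * right_p s,
   left_q s + m * right_q s, left_q s + m.+1 * right_q s)%N.
Proof.
rewrite /left_p /left_q /right_p /right_q /farey_quad !foldl_cat -/(farey_quad s).
case: (farey_quad s) => [[[a b] c] d] /=.
have -> : foldl farey_step (a, b, c, d) (nseq m false) =
    (a + m * b, b, c + m * d, d)%N.
  elim: m a c => [|m IH] a c /=; first by rewrite !mul0n !addn0.
  by rewrite IH; congr (_, _, _, _); lia.
by rewrite /=; congr (_, _, _, _); lia.
Qed.

(** Starting from the letter $A_0$ instead of the empty word makes the lower left entry 1 instead of
    0, so the right endpoint of the first Farey interval is finite. *)
Fixpoint liouville_word (k : nat) : seq bool :=
  if k is k'.+1 then
    let s := liouville_word k' in
    s ++ nseq (2 ^ (size s ^ 2)) false ++ [:: true]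
  else [:: false].

Lemma size_liouville_word k : (k < size (liouville_word k))%N.
Proof.
elim: k => [//|k IH]; rewrite /= !size_cat /= addn1 size_nseq; lia.
Qed.

Section LiouvilleNumber.
Variable R : realType.

Let m k : nat := (2 ^ (size (liouville_word k) ^ 2))%N.
Let a k : R := (left_p (liouville_word k))%:R.
Let b k : R := (right_p (liouville_word k))%:R.
Let c k : R := (left_q (liouville_word k))%:R.
Let d k : R := (right_q (liouville_word k))%:R.

Let aS k : a k.+1 = a k + (m k)%:R * b k.
Proof. by rewrite /a /left_p farey_quad_block /= natrD natrM. Qed.

Let cS k : c k.+1 = c k + (m k)%:R * d k.
Proof. by rewrite /c /left_q farey_quad_block /= natrD natrM. Qed.

Let bS k : b k.+1 = a k.+1 + b k.
Proof.
by rewrite aS /b /right_p farey_quad_block /= natrD natrM -natr1 mulrDl mul1r addrA.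
Qed.

Let dS k : d k.+1 = c k.+1 + d k.
Proof.
by rewrite cS /d /right_q farey_quad_block /= natrD natrM -natr1 mulrDl mul1r addrA.
Qed.

Let det k : a k * d k = b k * c k + 1.
Proof. by rewrite -!natrM farey_det natrD. Qed.

Let d_ge1 k : 1 <= d k. Proof. by rewrite ler1n right_q_gt0. Qed.

Let m_ge1 k : 1 <= (m k)%:R :> R. Proof. by rewrite ler1n expn_gt0. Qed.

Let c_ge0 k : 0 <= c k. Proof. exact: ler0n. Qed.

Let c_gt0 k : 0 < c k.
Proof.
case: k => [|k]; first exact: ltr01.
rewrite cS; have := c_ge0 k; have := d_ge1 k; have := m_ge1 k; nra.
Qed.

(** Endpoints of the Farey interval of the [k]-th word: its right column gives the left endpoint,
    its left column the right endpoint. *)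
Let l k := b k / d k.
Let u k := a k / c k.

Let d_gt0 k : 0 < d k. Proof. exact: lt_le_trans (d_ge1 k). Qed.

Let l_lt_u k : l k < u k.
Proof.
rewrite /l /u ltr_pdivrMr // mulrAC ltr_pdivlMr // det; lra.
Qed.

Let lS k : l k < l k.+1.
Proof.
rewrite /l ltr_pdivrMr // mulrAC ltr_pdivlMr // bS dS aS cS.
(* After cross-multiplication the two sides differ by exactly the determinant 1. *)
have := det k; nra.
Qed.

Let uS k : u k.+1 <= u k.
Proof.
rewrite /u ler_pdivrMr // mulrAC ler_pdivlMr // aS cS.
have := det k; have := m_ge1 k; nra.
Qed.

Let l_homo : {homo l : i j / (i <= j)%N >-> i <= j}.
Proof. by apply/nondecreasing_seqP => k; exact: ltW. Qed.

Let u_homo : {homo u : i j / (i <= j)%N >-> j <= i}.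
Proof. exact/nonincreasing_seqP. Qed.

Let l_le_u i j : l i <= u j.
Proof.
apply: (le_trans (l_homo _ _ (leq_maxl i j))).
by apply: (le_trans (ltW (l_lt_u _))); exact: u_homo (leq_maxr i j).
Qed.

Definition liouville_number : R := sup (range l).

Let alpha := liouville_number.

Let alpha_ge k : l k <= alpha.
Proof. by apply: ub_le_sup; [exists (u 0%N) => _ [i _ <-]|exists k]. Qed.

Let alpha_le k : alpha <= u k.
Proof.
by apply: ge_sup; [exists (l 0%N), 0%N|move=> _ [i _ <-]].
Qed.

Let form_gt0 k : 0 < alpha * d k - b k.
Proof.
rewrite subr_gt0 -ltr_pdivrMr //; exact: lt_le_trans (lS k) (alpha_ge _).
Qed.

Let form_le k : alpha * d k - b k <= (m k)%:R^-1.
Proof.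
have H : alpha * c k.+1 <= a k.+1 by rewrite -ler_pdivlMr //; exact: alpha_le.
rewrite -[X in _ <= X]mul1r ler_pdivlMr; last exact: lt_le_trans (m_ge1 k).
have alpha_d := form_gt0 k.
(* Since [alpha <= u k.+1], the left side is at most [a k.+1 * d k - b k * c k.+1], which equals the
   determinant 1. *)
have cd : (alpha * d k - b k) * c k.+1 <= 1.
  have : alpha * c k.+1 * d k <= a k.+1 * d k by rewrite ler_pM2r.
  by move: (det k); rewrite aS cS; nra.
apply: le_trans cd; rewrite ler_pM2l // cS.
have := c_ge0 k; have := d_ge1 k; have := m_ge1 k; nra.
Qed.

(** The first word has right column $(0, 1)$, so its linear form is [alpha] itself. *)
Lemma liouville_number_gt0 : 0 < liouville_number.
Proof. by have := form_gt0 0; rewrite /b /d /= mulr1 subr0. Qed.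

Lemma liouville_form_bounds k (s := liouville_word k) :
  0 < linear_form liouville_number (in_tuple s) <= (2 ^ (size s ^ 2))%:R^-1.
Proof.
rewrite /linear_form word_pE word_qE -!pmulrn.
by apply/andP; split; [exact: form_gt0|exact: form_le].
Qed.

(* If [alpha = p / q], then [q (alpha d - b)] is a positive integer, so
   [alpha d - b >= 1 / q], contradicting the bound [1 / m k] for large [k]. *)
Lemma liouville_number_irrational (p q : nat) :
  (0 < q)%N -> liouville_number * q%:R != p%:R.
Proof.
move=> q0; apply/eqP => E.
have qR : 0 < q%:R :> R by rewrite ltr0n.
(* The index [q] is large enough: its word has more than [q] letters, so [m q] is at least $2^q >
   q$. *)
have mq : q%:R < (m q)%:R :> R.
  rewrite ltr_nat; apply: (leq_trans (ltn_expl q (ltnSn 1))).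
  by rewrite leq_exp2l //; have := size_liouville_word q; nia.
have int_form : (alpha * d q - b q) * q%:R =
    (p%:Z * (right_q (liouville_word q))%:Z -
     (right_p (liouville_word q))%:Z * q%:Z)%:~R.
  by rewrite rmorphB !rmorphM /= -!pmulrn -E -/alpha -/(d q) -/(b q); ring.
have form_q : 0 < (alpha * d q - b q) * q%:R by rewrite mulr_gt0.
have : 1 <= (alpha * d q - b q) * q%:R.
  by move: form_q; rewrite int_form -[0]/(0%:~R) -[1]/(1%:~R) ltr_int ler_int; lia.
apply/negP; rewrite -ltNge.
apply: (@le_lt_trans _ _ ((m q)%:R^-1 * q%:R)); first by rewrite ler_pM2r.
by rewrite mulrC ltr_pdivrMr ?mul1r // (lt_trans qR).
Qed.

Lemma liouville_number_defined : partition_function_defined liouville_number.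
Proof.
move=> N w _; rewrite /linear_form word_pE word_qE -!pmulrn subr_eq0.
exact/liouville_number_irrational/right_q_gt0.
Qed.

(** All terms of the sum are nonnegative, so the single term of [liouville_word k] already gives the
    bound. *)
Lemma ln_partition_function_ge (beta : R) k (N := size (liouville_word k)) :
  0 <= beta ->
  beta * (N ^ 2)%:R * ln 2 <= ln (partition_function liouville_number beta N).
Proof.
move=> beta0; have /andP[L0 Lm] := liouville_form_bounds k.
set L := linear_form _ _ in L0 Lm.
have m0 : 0 < (2 ^ (N ^ 2))%:R :> R by rewrite ltr0n expn_gt0.
have term_ge : ((2 ^ (N ^ 2))%:R : R) `^ beta <= 1 / (`|L| `^ beta).
  rewrite gtr0_norm // ler_pdivlMr ?powR_gt0 // -powRM ?(ltW L0) ?(ltW m0) //.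
  rewrite [leRHS](_ : 1 = 1 `^ beta); last by rewrite powR1.
  apply: ge0_ler_powR => //.
  - by rewrite nnegrE ltW // mulr_gt0.
  - by rewrite nnegrE.
  - by rewrite -ler_pdivlMl // mulr1.
have Z_ge : ((2 ^ (N ^ 2))%:R : R) `^ beta <=
    partition_function liouville_number beta N.
  apply: (le_trans term_ge).
  rewrite /partition_function (bigD1 (in_tuple (liouville_word k))) //= lerDl.
  by apply: sumr_ge0 => w _; rewrite mul1r invr_ge0 powR_ge0.
have mb0 : 0 < ((2 ^ (N ^ 2))%:R : R) `^ beta by rewrite powR_gt0.
have Z0 := lt_le_trans mb0 Z_ge.
rewrite -ler_ln ?posrE // in Z_ge; apply: le_trans Z_ge.
by rewrite ln_powR (natrX _ 2 (N ^ 2)) lnXn // -[ln 2 *+ _]mulr_natl mulrA.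
Qed.

End LiouvilleNumber.

Theorem theorem4p3 (R : realType) :
  exists alpha : R,
    [/\ 0 < alpha, partition_function_defined alpha &
        ~ has_1_free_energy_limit alpha].
Proof.
exists (liouville_number R); split.
- exact: liouville_number_gt0.
- exact: liouville_number_defined.
case=> beta_c /(_ (`|beta_c| + 1)) [|l].
  by have := ler_norm beta_c; lra.
set f := (fun N : nat => _) => f_l.
have /cvg_seq_bounded[M [_ fM]] : cvgn f by apply/cvg_ex; exists l.
have ln2 : 0 < ln 2 :> R by rewrite ln_gt0 // ltr1n.
(* Every real above [M] bounds the convergent sequence [f]; [|M| + 1] is a positive one. *)
have M1 : M < `|M| + 1 by have := ler_norm M; lra.
pose k := Num.bound ((`|M| + 1) / ln 2).
pose N := size (liouville_word k).
have Nk : k%:R <= N%:R :> R by rewrite ler_nat ltnW // size_liouville_word.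
have N0 : 0 < N%:R :> R by rewrite ltr0n; exact: leq_trans (size_liouville_word k).
have kM : `|M| + 1 < k%:R * ln 2.
  rewrite -ltr_pdivrMr //; apply: archi_boundP.
  by rewrite divr_ge0 ?ltW // addr_ge0.
have beta0 : 0 <= `|beta_c| + 1 by rewrite addr_ge0.
(* Dividing the quadratic lower bound by [N] leaves a factor [N], which is at least [k]. *)
have fN : k%:R * ln 2 <= f N.
  rewrite /f ler_pdivlMr //; apply: le_trans (ln_partition_function_ge _ _ _ beta0).
  rewrite -/N natrX mulrAC ler_pM2r // expr2 mulrA ler_pM2r //.
  by apply: (le_trans Nk); rewrite ler_peMl ?(ltW N0) // lerDr.
have := fM _ M1 N I; rewrite /= => /(le_trans (ler_norm _)).
by apply/negP; rewrite -ltNge (lt_le_trans kM).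
Qed.
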